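(* Suppose that the Dynkin diagram of $G$ is not connected, and let $W=W_1\times W_2\times\cdots\times W_k$ be the corresponding factorization of the Weyl group (one factor for each connected component of the Dynkin diagram). Let $P$ and $Q$ be parabolic subgroups of $G$ containing $B$. Then $\mathcal{B}_P=\{\sigma_v\sigma_w : v\in W^P,\ w\in W_P\}$ and $\mathcal{B}_Q=\{\sigma_v\sigma_w : v\in W^Q,\ w\in W_Q\}$ are different bases of $H^*_T(G/B)$ if and only if for some factor $W_i$ both of the following hold: (1) $W_P\cap W_i$ differs from $W_Q\cap W_i$; and (2) at least one of $W_P\cap W_i$ and $W_Q\cap W_i$ is a nontrivial proper subgroup of $W_i$ (that is, different from both $\{e\}$ and $W_i$).
   Context: $G$ is a complex reductive linear algebraic group, $B$ a fixed Borel subgroup, $T\subseteq B$ the maximal torus, $W$ the Weyl group with simple reflections $s_1,\dots,s_n$ corresponding to the simple roots $\alpha_1,\dots,\alpha_n$, and $\ell$ the length function. For a parabolic subgroup $P\supseteq B$, $W_P\subseteq W$ is the associated subgroup (the Weyl group of $P/B$, generated by the simple reflections it contains), and $W^P$ is the set of minimal-length representatives of the cosets in $W/W_P$. $T$ acts by left multiplication; cohomology has coefficients in $\mathbb{C}$, and $\mathbb{C}[\mathfrak{t}^*]=H^*_T(pt)$ is the polynomial ring (symmetric algebra) on $\mathfrak{t}^*$, containing the roots as degree-one elements. The $T$-fixed points of $G/B$ are identified with $W$. Restriction to fixed points is injective, so $H^*_T(G/B)$ is regarded as a $\mathbb{C}[\mathfrak{t}^*]$-subalgebra of the ring of functions $W\to\mathbb{C}[\mathfrak{t}^*]$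 with pointwise operations. It is a free $\mathbb{C}[\mathfrak{t}^*]$-module with basis the equivariant Schubert classes $\{\sigma_w : w\in W\}$, given by Billey's formula: for $u\in W$ with any fixed reduced word $u=s_{b_1}\cdots s_{b_{\ell(u)}}$, set $\mathbf{r}(\mathbf{i},u)=s_{b_1}\cdots s_{b_{i-1}}(\alpha_{b_i})$; then $$\sigma_v(u)=\sum \prod_{i=1}^{\ell(v)}\mathbf{r}(\mathbf{j_i},u),$$ where the sum is over all $1\le j_1<\dots<j_{\ell(v)}\le \ell(u)$ such that $s_{b_{j_1}}\cdots s_{b_{j_{\ell(v)}}}$ is a reduced word for $v$. Products are taken in the ring $H^*_T(G/B)$. Each $\mathcal{B}_P$ is a $\mathbb{C}[\mathfrak{t}^*]$-module basis of $H^*_T(G/B)$. Bases are compared as subsets of $H^*_T(G/B)$. *)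

(* Defs.v *)
From HB Require Import structures.
From mathcomp Require Import all_boot all_order all_fingroup all_algebra.
From mathcomp Require Import finmap mpoly complex reals.

Set Implicit Arguments.
Unset Strict Implicit.
Unset Printing Implicit Defensive.

Import GRing.Theory.
Local Open Scope ring_scope.

(* A complex (connected) reductive group G with a Borel subgroup B and a
   maximal torus T in B is encoded by its based root datum: the characters of T
   form Z^r (row vectors), the cocharacters its dual (column vectors), and the
   n simple roots are those determined by B. *)
Record basedRootDatum := BasedRootDatum {
  torus_rank : nat;
  roots : finType;
  root : roots -> 'rV[int]_torus_rank;
  coroot : roots -> 'cV[int]_torus_rank;
  root_inj : injective root;
  coroot_inj : injective coroot;
  root_corootE : forall a, (root a *m coroot a) 0 0 = 2;
  root_reflection : forall a b,
    exists c, root c = root b - (root b *m coroot a) 0 0 *: root a;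
  coroot_reflection : forall a b,
    exists c, coroot c = coroot b - (root a *m coroot b) 0 0 *: coroot a;
  root_reduced : forall a b (k l : int), k != 0 ->
    k *: root b = l *: root a -> root b = root a \/ root b = - root a;
  semisimple_rank : nat;
  simple : 'I_semisimple_rank -> roots;
  simple_free : forall c : 'I_semisimple_rank -> int,
    \sum_i c i *: root (simple i) = 0 -> forall i, c i = 0;
  simple_base : forall a, exists c : 'I_semisimple_rank -> nat,
    root a = \sum_i root (simple i) *+ c i \/
    root a = - \sum_i root (simple i) *+ c i
}.

Section Weyl.
Variable D : basedRootDatum.
Local Notation n := (semisimple_rank D).

Definition refl_fun (a b : roots D) : roots D :=
  odflt b [pick c | root c == root b - (root b *m coroot a) 0 0 *: root a].

Lemma refl_funE (a b : roots D) :
  root (refl_fun a b) = root b - (root b *m coroot a) 0 0 *: root a.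
Proof.
rewrite /refl_fun; case: pickP => [c /eqP //|no].
by have [c /eqP Hc] := root_reflection a b; move: (no c); rewrite Hc.
Qed.

Lemma refl_fun_inj (a : roots D) : injective (refl_fun a).
Proof.
suff K : cancel (refl_fun a) (refl_fun a) by exact: can_inj K.
move=> b; apply: (@root_inj D); rewrite !refl_funE mulmxBl -scalemxAl.
set x := (root b *m coroot a) 0 0.
have -> : (root b *m coroot a - x *: (root a *m coroot a)) 0 0 = - x.
  rewrite [LHS]mxE -/x [X in _ + X]mxE [X in - X]mxE root_corootE.
  by rewrite mulr_natr mulr2n opprD addNKr.
by rewrite scaleNr opprK subrK.
Qed.

Definition reflection (a : roots D) : {perm roots D} := perm (@refl_fun_inj a).

(* The Weyl group acts faithfully on the roots, so it is realized there. *)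
Definition weylG : {group {perm roots D}} :=
  <<[set reflection (simple i) | i : 'I_n]>>%G.

Definition weyl : finGroupType := [subg weylG].

Definition simple_refl (i : 'I_n) : weyl := subg weylG (reflection (simple i)).

(* MathComp composes permutations from left to right; the product of Weyl group
   elements is composition of functions, (u v)(a) = u(v(a)). *)
Definition wmul (u v : weyl) : weyl := (v * u)%g.

Definition wprod (b : seq 'I_n) : weyl :=
  foldr (fun i u => wmul (simple_refl i) u) 1%g b.

Lemma wprod_surj (u : weyl) :
  exists m, [exists b : m.-tuple 'I_n, wprod b == u].
Proof.
suff [b <-] : exists b, wprod b = u.
  by exists (size b); apply/existsP; exists (in_tuple b).
have /gen_prodgP [m [c Hc Eu]] := valP u.
suff [b Hb] : exists b, val (wprod b) = (\prod_(i < m) c i)%g.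
  by exists b; apply: val_inj; rewrite Hb [RHS]Eu.
elim: m c Hc {Eu} => [|m IH] c Hc; first by exists [::]; rewrite big_ord0.
have [b Hb] := IH (fun i => c (widen_ord (leqnSn m) i)) (fun i => Hc _).
have /imsetP [i _ Ei] := Hc ord_max.
exists (i :: b); rewrite big_ord_recr /= -Hb Ei subgK //.
by apply: mem_gen; apply: imset_f.
Qed.

Definition len (u : weyl) : nat := ex_minn (wprod_surj u).

Definition reduced_word (b : seq 'I_n) (u : weyl) : bool :=
  (wprod b == u) && (size b == len u).

(* A parabolic subgroup P containing B is given by the set of the simple
   reflections lying in W_P. *)
Definition weylP (P : {set 'I_n}) : {group weyl} := <<[set simple_refl i | i in P]>>%G.

(* The elements of minimal length in their coset v W_P. *)
Definition minrep (P : {set 'I_n}) : {set weyl} :=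
  [set v | [forall w in weylP P, (len v <= len (wmul v w))%N]].

Definition dynkin : rel 'I_n := fun i j =>
  (i != j) && ((root (simple i) *m coroot (simple j)) 0 0 != 0).

Definition dynkin_connected : Prop := forall i j, connect dynkin i j.

Definition dynkin_components : {set {set 'I_n}} :=
  equivalence_partition (connect dynkin) [set: 'I_n].

End Weyl.

Section Cohomology.
Variables (R : realType) (D : basedRootDatum).
Local Notation n := (semisimple_rank D).

(* C[t^*]: the indeterminates are the standard basis of the character lattice. *)
Definition coefT := {mpoly R[i][torus_rank D]}.

Definition rootpoly (a : roots D) : coefT :=
  \sum_k (root a 0 k)%:~R *: 'X_k.

(* The ring of functions W -> C[t^*] containing H^*_T(G/B). *)
Definition fixfun := {ffun weyl D -> coefT}.

(* r(j, u) for the word b of u; positions are numbered from 0. *)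
Definition billey_root (b : seq 'I_n) (j : 'I_(size b)) : roots D :=
  sgval (wprod (take j b)) (simple (tnth (in_tuple b) j)).

(* The choices j_1 < ... < j_l(v) of positions in b are the masks m, the set of
   the chosen positions being the set of j with m_j = true. *)
Definition billey (b : seq 'I_n) (v : weyl D) : coefT :=
  \sum_(m : (size b).-tuple bool | reduced_word (mask m b) v)
    \prod_(j < size b | tnth m j) rootpoly (billey_root j).

(* The Schubert class of v, computed with the reduced words rw. *)
Definition schubert (rw : weyl D -> seq 'I_n) (v : weyl D) : fixfun :=
  [ffun u => billey (rw u) v].

(* Every such family is a C[t^*]-basis of H^*_T(G/B); bases are compared as
   subsets, and the elements of H^*_T(G/B) as functions on the fixed points. *)
Definition parabolic_basis (rw : weyl D -> seq 'I_n) (P : {set 'I_n}) :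
    {fset fixfun} :=
  [fset schubert rw v * schubert rw w | v in minrep P, w in weylP P]%fset.

End Cohomology.

(* Main.v *)
(** For [a], [b] joined by an edge of the Dynkin diagram, sigma_(s_a s_b) lies in
    B_P unless [a] is outside [P] and [b] is in [P].  In that case, for [v] in W^P
    and [w] in W_P, sigma_v sigma_w can be nonzero at s_a s_b only if [v] is 1 or
    s_a and [w] is 1 or s_b, and then it does not vanish at s_b s_a, where
    sigma_(s_a s_b) does.  So B_P determines the differences of the indicator
    function of [P] along the edges, hence [P] on each component where [P] is
    neither empty nor full.  Conversely, sigma_(x f) = sigma_x sigma_f when [x] and
    [f] lie in the factors of [W] attached to complementary unions of components,
    which lets one remove from [P] the components it contains without changing
    B_P. *)

Require Import Defs.
From mathcomp Require Import all_boot all_order all_fingroup all_algebra.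
From mathcomp Require Import finmap mpoly complex reals.
From mathcomp Require Import ring zify.

Set Implicit Arguments.
Unset Strict Implicit.
Unset Printing Implicit Defensive.

Import Order.TTheory GRing.Theory Num.Theory.

(** * Words in simple reflections acting on roots; standard subgroups *)

Section WeylGroup.
Import Defs.
Variable D : basedRootDatum.
Local Notation n := (semisimple_rank D).
Local Notation sroot i := (root (@simple D i)).
Local Notation s := (@simple_refl D).
Local Open Scope ring_scope.
Implicit Types (u v w x y : weyl D) (a b c : 'I_n) (P Q F : {set 'I_n}).

Lemma simple_lin_inj (c d : 'I_n -> int) :
  \sum_i c i *: sroot i = \sum_i d i *: sroot i -> c =1 d.
Proof.
move=> /eqP; rewrite -subr_eq0 -sumrB => /eqP E i.
apply/eqP; rewrite -subr_eq0.
rewrite (simple_free (c := fun i => c i - d i)) // -[RHS]E.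
by apply: eq_bigr => j _; rewrite scalerBl.
Qed.

Lemma sum_delta (x : int) a :
  \sum_i (x *+ (i == a)) *: sroot i = x *: sroot a.
Proof.
rewrite (bigD1 a) //= eqxx mulr1n big1 ?addr0 // => i /negPf ->.
by rewrite mulr0n scale0r.
Qed.

Lemma simple_pair_coef (x y : int) a b (c : 'I_n -> int) : a != b ->
  x *: sroot a + y *: sroot b = \sum_i c i *: sroot i -> c a = x /\ c b = y.
Proof.
move=> ab; rewrite -!sum_delta -big_split /=.
under eq_bigr do rewrite -scalerDl.
move=> /simple_lin_inj H; split; rewrite -H eqxx mulr1n.
  by rewrite (negPf ab) mulr0n addr0.
by rewrite eq_sym (negPf ab) mulr0n add0r.
Qed.

Lemma simple_pair_inj (x y z t : int) a b : a != b ->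
  x *: sroot a + y *: sroot b = z *: sroot a + t *: sroot b -> x = z /\ y = t.
Proof.
move=> ab; rewrite -(sum_delta z) -(sum_delta t) -big_split /=.
under [in RHS]eq_bigr do rewrite -scalerDl.
move=> /(simple_pair_coef ab) [<- <-]; rewrite !eqxx (negPf ab).
by rewrite eq_sym (negPf ab) !mulr0n addr0 add0r.
Qed.

Lemma simple_pair_sign (x y : int) a b (r : roots D) : a != b ->
  root r = x *: sroot a + y *: sroot b ->
  0 <= x /\ 0 <= y \/ x <= 0 /\ y <= 0.
Proof.
move=> ab; have [k [-> | ->]] := simple_base r => /esym E; [left | right].
  have [|<- <-] := @simple_pair_coef x y a b (fun i => (k i)%:Z) ab.
    by rewrite E; apply: eq_bigr => i _; rewrite -scaler_nat natz.
  by [].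
have [|<- <-] := @simple_pair_coef x y a b (fun i => - (k i)%:Z) ab.
  rewrite E -sumrN; apply: eq_bigr => i _.
  by rewrite -scaler_nat natz scaleNr.
by rewrite !oppr_le0.
Qed.

Lemma root_neq0 (r : roots D) : root r != 0.
Proof.
apply/eqP => E; have := root_corootE r; rewrite E mul0mx mxE.
by move/eqP; rewrite eq_sym.
Qed.

Lemma weyl_ext u v : (forall r, root (sgval u r) = root (sgval v r)) -> u = v.
Proof. by move=> H; apply/val_inj/permP => r; apply: root_inj. Qed.

Lemma wmul_act u v r : sgval (wmul u v) r = sgval u (sgval v r).
Proof. by rewrite /wmul /= permM. Qed.

Local Notation pair r a := ((root r *m coroot (@simple D a)) 0 0).

Lemma simple_refl_act a r : root (sgval (s a) r) = root r - pair r a *: sroot a.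
Proof.
rewrite /simple_refl subgK; last by apply: mem_gen; apply: imset_f.
by rewrite permE refl_funE.
Qed.

Lemma simple_refl_self a : root (sgval (s a) (simple a)) = - sroot a.
Proof.
by rewrite simple_refl_act root_corootE scaler_nat mulr2n opprD addNKr.
Qed.

Lemma pair_refl a c r :
  pair (sgval (s a) r) c = pair r c - pair r a * pair (simple a) c.
Proof.
rewrite simple_refl_act mulmxBl -scalemxAl [LHS]mxE; congr (_ + _).
by rewrite [LHS]mxE [X in - X]mxE.
Qed.

Lemma simple_refl_act2 a c r :
  root (sgval (s a) (sgval (s c) r)) = root r - pair r c *: sroot c
    - (pair r a - pair r c * pair (simple c) a) *: sroot a.
Proof. by rewrite simple_refl_act pair_refl simple_refl_act. Qed.

Lemma simple_refl_sq a : (s a * s a = 1)%g.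
Proof.
apply: weyl_ext => r; rewrite -[(_ * _)%g]/(wmul _ _) wmul_act.
rewrite simple_refl_act2 root_corootE perm1 mulr_natr mulr2n opprD addrA subrr add0r.
by rewrite scaleNr opprK subrK.
Qed.

Lemma wprod_cat (p q : seq 'I_n) : wprod (p ++ q) = wmul (wprod p) (wprod q).
Proof.
elim: p => [|i p IH] /=; first by rewrite /wmul mulg1.
by rewrite IH /wmul mulgA.
Qed.

Lemma wprod1 a : wprod [:: a] = s a.
Proof. by rewrite /= /wmul mul1g. Qed.

Lemma wprod2 a c : wprod [:: a; c] = (s c * s a)%g.
Proof. by rewrite /= /wmul mul1g. Qed.

(** Each letter changes a root by a multiple of its own simple root. A nonzero coefficient in the
    total displacement thus certifies that the letter occurs in every word for the element. *)
Lemma wprod_diff (p : seq 'I_n) (r : roots D) : exists2 k : 'I_n -> int,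
  forall i, i \notin p -> k i = 0 &
  root (sgval (wprod p) r) = root r + \sum_i k i *: sroot i.
Proof.
elim: p => [|a p [k k0 E]] /=.
  exists (fun=> 0) => //; rewrite perm1 big1 ?addr0 // => i _.
  by rewrite scale0r.
exists (fun i => k i + (- pair (sgval (wprod p) r) a) *+ (i == a)).
  move=> i; rewrite inE negb_or => /andP[/negPf -> /k0 ->].
  by rewrite mulr0n addr0.
rewrite wmul_act simple_refl_act {1}E -addrA; congr (_ + _).
under [RHS]eq_bigr do rewrite scalerDl.
by rewrite big_split /= sum_delta scaleNr.
Qed.

Lemma weylP_wordP u P :
  reflect (exists2 p, all (mem P) p & wprod p = u) (u \in weylP P).
Proof.
apply: (iffP idP) => [|[p Hp <-]]; last first.
  elim: p Hp => [|a p IH] /=; first by rewrite group1.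
  case/andP => aP /IH H; rewrite /wmul groupM // mem_gen //.
  by apply: imset_f.
case/gen_prodgP => m [c Hc ->] {u}.
elim: m c Hc => [|m IH] c Hc; first by exists [::]; rewrite ?big_ord0.
have [p Hp E] := IH (fun i => c (widen_ord (leqnSn m) i)) (fun i => Hc _).
have /imsetP [i iP Ei] := Hc ord_max.
by exists (i :: p); rewrite /= ?iP // big_ord_recr /= -E Ei.
Qed.

Lemma weylP_diff u P (r : roots D) : u \in weylP P -> exists2 k : 'I_n -> int,
  forall i, i \notin P -> k i = 0 &
  root (sgval u r) = root r + \sum_i k i *: sroot i.
Proof.
case/weylP_wordP => p /allP Hp <-; have [k k0 E] := wprod_diff p r.
by exists k => // i iP; apply: k0; apply: contra iP; apply: Hp.
Qed.

(** [s_a] moves its own simple root by -2 times that root, whereas W_P displaces roots only within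
    the span of the simple roots in [P]. *)
Lemma simple_refl_weylP a P : (s a \in weylP P) = (a \in P).
Proof.
apply/idP/idP => [/(weylP_diff (simple a)) [k k0]|aP]; last first.
  by apply: mem_gen; apply: imset_f.
rewrite simple_refl_self => E; apply/negPn/negP => /k0 ka.
have {}E : (- 2) *: sroot a = \sum_i k i *: sroot i.
  by rewrite -[RHS](addKr (sroot a)) -E scaleNr scaler_nat mulr2n opprD.
by move: E; rewrite -sum_delta => /simple_lin_inj /(_ a); rewrite ka eqxx.
Qed.

(** [P] is recovered as the set of [a] with [s_a] in W_P, so conditions on subgroups can be read on
    sets of vertices. *)
Lemma weylP_inj : injective (fun P => weylP P : {set weyl D}).
Proof.
by move=> P Q E; apply/setP => a; rewrite -!simple_refl_weylP /= -!topredE /= E.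
Qed.

Lemma weylP0 : weylP set0 = [set 1%g] :> {set weyl D}.
Proof. by rewrite /= imset0 gen0. Qed.

Lemma weylP_sub P Q : P \subset Q -> weylP P \subset weylP Q.
Proof. by move=> PQ; apply: genS; apply: imsetS. Qed.

(** The displacement of a root lies in the spans of two disjoint sets of simple roots, so it is zero
    and [u] fixes every root. *)
Lemma weylP_disjoint P Q u :
  [disjoint P & Q] -> u \in weylP P -> u \in weylP Q -> u = 1%g.
Proof.
move=> dPQ uP uQ; apply: weyl_ext => r; rewrite perm1.
have [k k0 E] := weylP_diff r uP; have [l l0 E'] := weylP_diff r uQ.
rewrite E big1 ?addr0 // => i _.
have [iP|/k0->] := boolP (i \in P); last by rewrite scale0r.
have /simple_lin_inj -> : \sum_i k i *: sroot i = \sum_i l i *: sroot i.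
  by apply: (@addrI _ (root r)); rewrite -E.
by rewrite l0 ?scale0r // (disjointFr dPQ).
Qed.

(* The root s_b s_a (a_b) is - a_b - k a_a when s_b fixes a_a, and s_a (a_b) is
   a_b - k a_a: the coefficients of a root have the same sign, so k = 0. *)
Lemma orthogonal_sym a b : a != b ->
  pair (simple a) b = 0 -> pair (simple b) a = 0.
Proof.
move=> ab ab0.
have E1 := simple_refl_act a (simple b).
have E2 : root (sgval (s b) (sgval (s a) (simple b))) =
    (- pair (simple b) a) *: sroot a + (-1) *: sroot b.
  rewrite simple_refl_act pair_refl ab0 mulr0 subr0 root_corootE E1.
  by rewrite scaler_nat mulr2n opprD addrAC addNKr addrC scaleNr scaleN1r addrC.
have E3 : root (sgval (s a) (simple b)) =
    (- pair (simple b) a) *: sroot a + 1 *: sroot b.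
  by rewrite E1 scaleNr scale1r addrC.
have := simple_pair_sign ab E3; have := simple_pair_sign ab E2.
rewrite !(ler0N1, lerN10, ler01, ler10, oppr_le0, oppr_ge0).
move=> H1 H2; apply/eqP; rewrite eq_le; apply/andP.
by case: H1 => -[? ?]; case: H2 => -[? ?].
Qed.

Lemma dynkin_sym : ssrbool.symmetric (@dynkin D).
Proof.
move=> a b; rewrite /dynkin eq_sym; have [//|ba] /= := eqVneq b a.
by congr (~~ _); apply/eqP/eqP; apply: orthogonal_sym; rewrite // eq_sym.
Qed.

Lemma orthogonal_commute a b : a != b -> ~~ dynkin a b -> commute (s a) (s b).
Proof.
move=> ab; rewrite /dynkin ab negbK /= => /eqP E.
have E' := orthogonal_sym ab E.
apply: weyl_ext => r; rewrite -![(_ * _)%g]/(wmul _ _) !wmul_act.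
by rewrite !simple_refl_act2 E E' !mulr0 !subr0 addrAC.
Qed.

End WeylGroup.

(** * Length: products of two adjacent reflections, splitting along components *)

Section Length.
Import Defs.
Local Open Scope ring_scope.
Variable D : basedRootDatum.
Local Notation n := (semisimple_rank D).
Local Notation sroot i := (root (@simple D i)).
Local Notation s := (@simple_refl D).
Local Notation pair r a := ((root r *m coroot (@simple D a)) 0 0).
Implicit Types (u v w x y f : weyl D) (a b c : 'I_n) (P Q F : {set 'I_n}).
Implicit Types p q : seq 'I_n.

Lemma len_wprod_le p : (len (wprod p) <= size p)%N.
Proof.
rewrite /len; case: ex_minnP => m _; apply.
by apply/existsP; exists (in_tuple p).
Qed.

Lemma len_wordP u : exists2 p, wprod p = u & size p = len u.
Proof.
rewrite /len; case: ex_minnP => m /existsP[p /eqP E] _.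
by exists p => //; rewrite size_tuple.
Qed.

Lemma reduced_wordP p u :
  reflect (wprod p = u /\ size p = len u) (reduced_word p u).
Proof. by apply: (iffP andP) => -[/eqP ? /eqP ?]. Qed.

Lemma len1 : len (1 : weyl D)%g = 0%N.
Proof. by apply/eqP; rewrite -leqn0; apply: (len_wprod_le [::]). Qed.

Lemma wprod2_act a b (r : roots D) :
  sgval (wprod [:: a; b]) r = sgval (s a) (sgval (s b) r).
Proof. by rewrite wprod2 -[(_ * _)%g]/(wmul _ _) wmul_act. Qed.

Lemma simple_refl_neq1 a : s a != 1%g.
Proof.
apply/eqP => E; have := simple_refl_self a; rewrite E perm1.
rewrite -[LHS]scale1r -scaleN1r -!sum_delta => /simple_lin_inj /(_ a).
by rewrite eqxx.
Qed.

Lemma simple_refl_inv a : (s a)^-1%g = s a.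
Proof. by apply/eqP; rewrite eq_invg_mul simple_refl_sq. Qed.

Lemma simple_refl_inj : injective s.
Proof.
move=> a b E; apply/set1P; rewrite -simple_refl_weylP E simple_refl_weylP.
exact: set11.
Qed.

Lemma len_simple_refl a : len (s a) = 1%N.
Proof.
have := len_wprod_le [:: a]; rewrite wprod1 leq_eqVlt => /orP[/eqP //|/=].
rewrite ltnS leqn0 => /eqP E.
have [[|c p] /= Ep] := len_wordP (s a); last by rewrite E.
by have := simple_refl_neq1 a; rewrite -Ep eqxx.
Qed.

(* As [s_a s_b] sends the simple root of [b] to a combination of the simple
   roots of [a] and [b] with nonzero coefficients, no word for [s_a s_b] avoids
   [a] or [b]. *)
Lemma dynkin_word a b p :
  dynkin a b -> wprod p = wprod [:: a; b] -> a \in p /\ b \in p.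
Proof.
rewrite dynkin_sym => /andP[ba m0] E.
have [k k0] := wprod_diff p (simple b).
rewrite E wprod2_act simple_refl_act2 root_corootE.
rewrite scaler_nat mulr2n opprD addrA subrr sub0r.
set m := pair (simple b) a - _ => E'.
have mE : m = - pair (simple b) a.
  by rewrite /m mulrC mulr_natr mulr2n opprD addrA subrr add0r.
have {}E' : (- 2) *: sroot b + (- m) *: sroot a = \sum_i k i *: sroot i.
  rewrite -[RHS](addKr (sroot b)) -E' !scaleNr scaler_nat mulr2n opprD.
  by rewrite -addrA.
have [kb ka] := simple_pair_coef ba E'.
split; apply/negPn/negP => /k0; rewrite ?ka ?kb //.
by rewrite mE opprK => /eqP; apply/negP.
Qed.

Lemma dynkin_pair_weylP a b P :
  dynkin a b -> (wprod [:: a; b] \in weylP P) = (a \in P) && (b \in P).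
Proof.
move=> ab; apply/idP/andP => [/weylP_wordP[p /allP pP E]|[aP bP]].
  by have [/pP ? /pP] := dynkin_word ab E.
by apply/weylP_wordP; exists [:: a; b]; rewrite //= aP bP.
Qed.

(** The two products send the simple root a_b to -a_b + k a_a and to (k m - 1) a_b - k a_a; equality
    would give 2k = 0, but k is nonzero on an edge. *)
Lemma dynkin_noncomm a b : dynkin a b -> wprod [:: a; b] != wprod [:: b; a].
Proof.
rewrite dynkin_sym => /andP[ba k0].
apply/eqP => /(congr1 (fun u => root (sgval u (simple b)))).
rewrite !wprod2_act !simple_refl_act2 root_corootE.
set m := pair (simple a) b; set k := pair (simple b) a => E.
have [|_ /eqP] := @simple_pair_inj D (- 1) k (k * m - 1) (- k) b a ba.
  have -> : - 1 *: sroot b + k *: sroot a =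
      sroot b - 2 *: sroot b - (k - 2 * k) *: sroot a.
    rewrite -[X in X - 2 *: _]scale1r -scalerBl -scaleNr.
    by congr (_ *: _ + _ *: _); ring.
  rewrite E -[X in X - k *: _]scale1r addrAC -scalerBl -scaleNr.
  by congr (_ *: _ + _ *: _); ring.
by rewrite -subr_eq0 opprK -mulr2n mulrn_eq0 (negPf k0).
Qed.

Lemma dynkin_pair_len a b : dynkin a b -> len (wprod [:: a; b]) = 2%N.
Proof.
move=> ab; apply/eqP; rewrite eqn_leq len_wprod_le /=.
have [p E <-] := len_wordP (wprod [:: a; b]).
have [ap bp] := dynkin_word ab E; have /andP[a_b _] := ab.
by case: p ap bp {E} => [|c [|]] //; rewrite !inE => /eqP<- /eqP /esym/eqP; rewrite (negPf a_b).
Qed.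

(** A reduced word has two letters, among them [a] and [b], and [dynkin_noncomm] excludes the other
    order. Uniqueness makes Billey's formula at this element explicit. *)
Lemma dynkin_pair_reduced a b p :
  dynkin a b -> reduced_word p (wprod [:: a; b]) = (p == [:: a; b]).
Proof.
move=> ab; apply/reduced_wordP/eqP => [[E]|->]; last first.
  by rewrite dynkin_pair_len.
rewrite dynkin_pair_len //; have [ap bp] := dynkin_word ab E.
have /andP[a_b _] := ab.
case: p ap bp E => [|c [|d []]] //; rewrite !inE => ap bp E _.
move: ap bp E => /orP[]/eqP<- /orP[]/eqP E'; rewrite -?E' ?eqxx // in a_b *.
by have := dynkin_noncomm ab; rewrite E' => /eqP H /esym.
Qed.

(** If [b] is in [P], multiplying by [s_b] leaves the shorter [s_a]. Otherwise the only [w] that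
    could shorten s_a s_b is s_b s_a s_b, which is not in W_P. *)
Lemma dynkin_pair_minrep a b P :
  dynkin a b -> (wprod [:: a; b] \in minrep P) = (b \notin P).
Proof.
move=> ab; rewrite inE; apply/forall_inP/idP => [H|bP w wP].
  apply/negP => bP; have := H (s b); rewrite simple_refl_weylP => /(_ bP).
  rewrite dynkin_pair_len // wprod2 /wmul mulgA simple_refl_sq mul1g.
  by rewrite len_simple_refl.
rewrite dynkin_pair_len // leqNgt; apply/negP => short.
have [p Ep szp] := len_wordP (wmul (wprod [:: a; b]) w).
have /weylP_wordP[q /allP qP Eq] := wP.
(* A word [p] of at most one letter is its own inverse, so [w] followed by [p] is the inverse of s_a
   s_b. *)
have Ew : wprod (q ++ p) = wprod [:: b; a].
  have E2 : wprod [:: b; a] = (wprod [:: a; b])^-1%g.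
    by rewrite !wprod2 invMg !simple_refl_inv.
  rewrite E2 wprod_cat Eq.
  have -> : wprod p = (wprod p)^-1%g.
    move: short; rewrite -szp; case: (p) => [|c []] // _.
      by rewrite invg1.
    by rewrite wprod1 simple_refl_inv.
  by rewrite Ep /wmul invMg mulgKV.
have ba : dynkin b a by rewrite dynkin_sym.
have [] := dynkin_word ba Ew; rewrite !mem_cat.
(* [b] occurs in [q ++ p] but not in [q], so [p] is the single letter [b]. *)
have /negPf -> : b \notin q by apply: contra bP; apply: qP.
move: short Ew; rewrite -szp.
case: (p) => [|c []] // _ Ew.
rewrite mem_seq1 => /eqP bc _; rewrite -{c}bc in Ew.
have {Ew} Ew : w = wprod [:: b; a; b].
  rewrite -[[:: b; a; b]]/([:: b; a] ++ [:: b]) wprod_cat -Ew wprod_cat.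
  by rewrite Eq wprod1 /wmul mulgA simple_refl_sq mul1g.
have [k k0] := weylP_diff (simple b) wP; rewrite {}Ew.
rewrite -[[:: b; a; b]]/([:: b; a] ++ [:: b]) wprod_cat wmul_act wprod1.
rewrite wprod2_act simple_refl_act2 !pair_refl root_corootE simple_refl_self.
set m := pair (simple a) b; set l := pair (simple b) a => E.
have a_b : b != a by have /andP[] := ba.
(* [w] displaces a_b by -l m a_b + l a_a, and l m is nonzero on an edge. *)
have [|kb _] := @simple_pair_coef D (- (l * m)) l b a k a_b.
  apply: (@addrI _ (sroot b)); rewrite -E addrA [RHS]addrAC -!scaleNr.
  rewrite -scaleN1r -{1}[sroot b]scale1r -!scalerDl.
  by congr (_ *: _ + _ *: _); ring.
have := k0 _ bP; rewrite kb => /eqP.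
have [/andP[_ m0] /andP[_ l0]] := (ab, ba).
by rewrite oppr_eq0 mulf_eq0 (negPf m0) (negPf l0).
Qed.

(** A set closed under [dynkin] is a union of components, so no edge joins a generator of one
    subgroup to a generator of the other. *)
Lemma closed_commute F x f : closed (@dynkin D) F ->
  x \in weylP (~: F) -> f \in weylP F -> commute x f.
Proof.
move=> Fcl xF fF; suff /centsP : weylP (~: F) \subset 'C(weylP F)%g.
  exact.
rewrite /= cent_gen gen_subG; apply/centsP => _ /imsetP[a aF ->].
move=> _ /imsetP[b bF ->]; rewrite inE in aF.
apply: orthogonal_commute.
  by apply: contraNneq aF => ->.
by apply: contra aF => /Fcl ->.
Qed.

Lemma filter_weylP F p : wprod [seq a <- p | a \in F] \in weylP F.
Proof. by apply/weylP_wordP; exists [seq a <- p | a \in F]; rewrite ?filter_all. Qed.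

Lemma filterC_weylP F p : wprod [seq a <- p | a \notin F] \in weylP (~: F).
Proof.
apply/weylP_wordP; exists [seq a <- p | a \notin F] => //.
by apply/allP => a; rewrite mem_filter !inE => /andP[].
Qed.

Lemma wprod_split F p : closed (@dynkin D) F ->
  wprod p = (wprod [seq a <- p | a \notin F] * wprod [seq a <- p | a \in F])%g.
Proof.
move=> Fcl; elim: p => [|a p IH]; first by rewrite mulg1.
rewrite /= IH; have [aF|aF] := boolP (a \in F); rewrite /= /wmul -!mulgA //.
congr (_ * _)%g; apply/commute_sym/(closed_commute Fcl); rewrite ?filter_weylP //.
by rewrite simple_refl_weylP inE.
Qed.

(** The element y^-1 x = g f^-1 lies in both factors, which meet trivially. *)
Lemma closed_split_inj F x f y g : closed (@dynkin D) F ->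
  x \in weylP (~: F) -> f \in weylP F -> y \in weylP (~: F) -> g \in weylP F ->
  (x * f = y * g)%g -> x = y /\ f = g.
Proof.
move=> Fcl xF fF yF gF E.
have E' : (y^-1 * x = g * f^-1)%g by rewrite -[x](mulgK f) E -mulgA mulKg.
have /(congr1 (mulg y)) : (y^-1 * x = 1)%g.
  apply: (@weylP_disjoint D F (~: F)); last by rewrite groupM ?groupV.
    by rewrite -subsets_disjoint.
  by rewrite E' groupM ?groupV.
rewrite mulKVg mulg1 => xy; split=> //.
by move: E; rewrite xy => /mulgI.
Qed.

Lemma wprod_split_eq F p x f : closed (@dynkin D) F ->
  x \in weylP (~: F) -> f \in weylP F -> wprod p = (x * f)%g ->
  wprod [seq a <- p | a \notin F] = x /\ wprod [seq a <- p | a \in F] = f.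
Proof.
move=> Fcl xF fF; rewrite (wprod_split p Fcl).
by apply: (closed_split_inj Fcl); rewrite ?filterC_weylP ?filter_weylP.
Qed.

Lemma size_split F p :
  size p = (size [seq a <- p | a \notin F] + size [seq a <- p | a \in F])%N.
Proof.
by rewrite !size_filter addnC count_predC.
Qed.

(** Concatenation gives one inequality. For the other, the letters of a shortest word of the product
    separate into words for [x] and for [f]. *)
Lemma len_closed F x f : closed (@dynkin D) F ->
  x \in weylP (~: F) -> f \in weylP F -> len (x * f)%g = (len x + len f)%N.
Proof.
move=> Fcl xF fF; apply/eqP; rewrite eqn_leq; apply/andP; split.
  have [p Ep <-] := len_wordP x; have [q Eq <-] := len_wordP f.
  rewrite addnC -size_cat.
  by have := len_wprod_le (q ++ p); rewrite wprod_cat /wmul Ep Eq.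
have [p Ep <-] := len_wordP (x * f)%g; rewrite (size_split F p).
by have [<- <-] := wprod_split_eq Fcl xF fF Ep; rewrite leq_add ?len_wprod_le.
Qed.

Lemma closed_mul_sub F P u : closed (@dynkin D) F -> u \in weylP P ->
  exists x f, [/\ x \in weylP (P :\: F), f \in weylP (P :&: F) & u = (x * f)%g].
Proof.
move=> Fcl /weylP_wordP[p /allP pP <-]; rewrite (wprod_split p Fcl).
do 2!eexists; split; last reflexivity; apply/weylP_wordP.
  exists [seq a <- p | a \notin F] => //; apply/allP => a.
  by rewrite mem_filter /= !inE => /andP[-> /pP].
exists [seq a <- p | a \in F] => //; apply/allP => a.
by rewrite mem_filter !inE => /andP[-> /pP]; rewrite andbT.
Qed.

(** An element of W_P splits as x f within W_P; if it lies in W_F, uniqueness of the splitting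
    forces x = 1. *)
Lemma weylP_cap_closed F P : closed (@dynkin D) F ->
  weylP P :&: weylP F = weylP (P :&: F) :> {set weyl D}.
Proof.
move=> Fcl; apply/eqP; rewrite eqEsubset; apply/andP; split; last first.
  by rewrite subsetI !weylP_sub ?subsetIl ?subsetIr.
apply/subsetP => u /setIP[/(closed_mul_sub Fcl) [x [f [xP fP ->]]] uF].
have fF : f \in weylP F by apply: subsetP fP; rewrite weylP_sub ?subsetIr.
have xF : x \in weylP (~: F).
  by apply: subsetP xP; rewrite weylP_sub // setDE subsetIr.
have [] := @closed_split_inj F x f 1%g (x * f)%g Fcl xF fF _ uF.
- exact: group1.
- by rewrite mul1g.
by move=> -> _; rewrite mul1g.
Qed.

End Length.

(** * Billey's formula on a fixed word: support and multiplicativity *)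

Section Billey.
Import Defs.
Local Open Scope ring_scope.
Variables (R : realType) (D : basedRootDatum).
Local Notation n := (semisimple_rank D).
Local Notation s := (@simple_refl D).
Implicit Types (u v w x y f : weyl D) (a b c : 'I_n) (P Q F : {set 'I_n}).
Implicit Types p q : seq 'I_n.

Lemma rootpoly_neq0 (r : roots D) : rootpoly R r != 0.
Proof.
apply: contra (root_neq0 r) => /eqP E; apply/eqP/rowP => k; rewrite mxE.
have := congr1 (mcoeff U_(k)%MM) E.
rewrite /rootpoly raddf_sum mcoeff0 (bigD1 k) //= big1 => [|j jk].
  by rewrite mcoeffZ mcoeffX eqxx mulr1 addr0 => /eqP; rewrite intr_eq0 => /eqP.
by rewrite mcoeffZ mcoeffX eq_mnm1 (negPf jk) mulr0.
Qed.

(** A single contributing mask leaves no room for cancellation: the value is one product of nonzero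
    linear forms over a domain. *)
Lemma billey_neq0 p v (m0 : bitseq) : size m0 = size p ->
  (forall m : bitseq, size m = size p -> reduced_word (mask m p) v = (m == m0)) ->
  billey R p v != 0.
Proof.
move=> /eqP sz0 H; rewrite /billey (big_pred1 (Tuple sz0)) => [|m].
  by apply/prodf_neq0 => j _; apply: rootpoly_neq0.
by rewrite H ?size_tuple.
Qed.

Lemma billey_supp p v : billey R p v != 0 ->
  exists2 m : bitseq, size m = size p & reduced_word (mask m p) v.
Proof.
move=> H; suff /existsP[m Hm] :
    [exists m : (size p).-tuple bool, reduced_word (mask m p) v].
  by exists m; rewrite ?size_tuple.
apply: contraR H => /existsPn H.
by rewrite /billey big_pred0 // => m; apply/negbTE/H.
Qed.

Lemma reduced_word_nil p : reduced_word p (1 : weyl D)%g = (p == [::]).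
Proof.
apply/reduced_wordP/eqP => [[_]|->]; last by rewrite len1.
by rewrite len1; apply: size0nil.
Qed.

Lemma mask_tnth p (m : (size p).-tuple bool) (A : pred 'I_n) j :
  all A (mask m p) -> tnth m j -> A (tnth (in_tuple p) j).
Proof.
have szm := size_tuple m; have ltj := ltn_ord j.
rewrite (tnth_nth false) (tnth_nth (tnth (in_tuple p) j)) /=.
move: (tnth _ _) => i0; move: (tval m) (nat_of_ord j) szm ltj => {}m {}j.
elim: p m j => [|a p IH] [|c m] //= [|j] //=.
  by case: c => //= _ _ /andP[].
move=> [szm] ltj H; apply: IH => //.
by move: H; case: c => //= /andP[].
Qed.

Lemma billey1 p : billey R p 1%g = 1.
Proof.
rewrite /billey (big_pred1 [tuple of nseq (size p) false]) => [|m].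
  by rewrite big_pred0 // => j; rewrite tnth_nseq.
rewrite reduced_word_nil; apply/eqP/eqP => [E|->]; last exact: mask_false.
apply: eq_from_tnth => j; rewrite tnth_nseq; apply/negbTE/negP => mj.
by have := mask_tnth (A := pred0) _ mj; rewrite E => /(_ isT).
Qed.

(** The result is again a mask on the whole word [p], because [billey_root] refers to positions and
    prefixes of [p]. *)
Definition mask_restrict (A : pred 'I_n) p (m : (size p).-tuple bool) :=
  [tuple tnth m j && A (tnth (in_tuple p) j) | j < size p].

Lemma mask_restrictE (A : pred 'I_n) p (m : (size p).-tuple bool) :
  mask (mask_restrict A m) p = filter A (mask m p).
Proof.
have -> : mask_restrict A m = [seq z.1 && A z.2 | z <- zip m p] :> seq bool.
  have szm : size m = size p by rewrite size_tuple.
  apply: (@eq_from_nth _ false).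
    by rewrite size_map size1_zip ?size_tuple.
  rewrite size_tuple => j ltj; set i := Ordinal ltj.
  rewrite -[j]/(nat_of_ord i) -tnth_nth tnth_mktuple.
  rewrite (nth_map (false, tnth (in_tuple p) i)) ?size1_zip ?szm //.
  rewrite nth_zip //= (tnth_nth false); congr (_ && A _).
  by rewrite {1}(tnth_nth (tnth (in_tuple p) i)).
case: m => m /= /eqP; elim: p m => [|a p IH] [|c m] //= [szm].
by rewrite IH //; case: c => /=; case: (A a).
Qed.

(** Each filtered word is at least as long as the element it represents, while the total lengths
    agree, so neither inequality is strict. *)
Lemma reduced_word_split F p x f : closed (@dynkin D) F ->
  x \in weylP (~: F) -> f \in weylP F ->
  reduced_word p (x * f)%g =
  reduced_word [seq a <- p | a \notin F] x && reduced_word [seq a <- p | a \in F] f.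
Proof.
move=> Fcl xF fF; apply/reduced_wordP/andP => [[E]|].
  have [Ex Ef] := wprod_split_eq Fcl xF fF E.
  rewrite (len_closed Fcl) // (size_split F) => szE.
  have := len_wprod_le [seq a <- p | a \notin F].
  have := len_wprod_le [seq a <- p | a \in F].
  rewrite Ex Ef => l1 l2.
  have addn_tight (k l i j : nat) :
      (k + l = i + j)%N -> (j <= l)%N -> (i <= k)%N -> k = i /\ l = j by lia.
  have [sx sf] := addn_tight _ _ _ _ szE l1 l2.
  split; apply/reduced_wordP.
    by rewrite Ex; split; [|exact sx].
  by rewrite Ef; split; [|exact sf].
case=> /reduced_wordP [Ex sx] /reduced_wordP [Ef sf].
by rewrite (wprod_split p Fcl) Ex Ef (len_closed Fcl) // (size_split F) sx sf.
Qed.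

Lemma reduced_word_closedC F p x : closed (@dynkin D) F ->
  x \in weylP (~: F) -> reduced_word p x -> all (fun a => a \notin F) p.
Proof.
move=> Fcl xF; rewrite -{1}[x]mulg1 (@reduced_word_split F) //.
rewrite reduced_word_nil => /andP[_] /eqP E.
apply/allP => a ap; apply: contraT; rewrite negbK => aF.
by have := mem_filter (fun a => a \in F) a p; rewrite E in_nil aF ap.
Qed.

Lemma reduced_word_closed F p f : closed (@dynkin D) F ->
  f \in weylP F -> reduced_word p f -> all (fun a => a \in F) p.
Proof.
move=> Fcl fF; rewrite -{1}[f]mul1g (@reduced_word_split F) //.
rewrite reduced_word_nil => /andP[/eqP E _].
apply/allP => a ap; apply: contraT => aF.
by have := mem_filter (fun a => a \notin F) a p; rewrite E in_nil aF ap.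
Qed.

(** Masks for x f correspond to pairs of masks for x and for f, by separating the selected letters
    according to [F]. The root at a position depends on [p] and not on the mask, so each product of
    roots factors. *)
Lemma billey_closed F p x f : closed (@dynkin D) F ->
  x \in weylP (~: F) -> f \in weylP F ->
  billey R p (x * f)%g = billey R p x * billey R p f.
Proof.
move=> Fcl xF fF; rewrite /billey big_distrlr pair_big /=.
pose join (m : (size p).-tuple bool * (size p).-tuple bool) :=
  [tuple tnth m.1 j || tnth m.2 j | j < size p].
pose split (m : (size p).-tuple bool) :=
  (mask_restrict (fun a => a \notin F) m, mask_restrict (fun a => a \in F) m).
rewrite [RHS](@reindex_onto _ _ _ _ _ split join) => [|[m1 m2] /= /andP[]].
  apply: eq_big => [m|m _].
    rewrite (reduced_word_split _ Fcl) // -!mask_restrictE.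
    rewrite -[LHS]andbT; congr (_ && _); apply/esym/eqP/eq_from_tnth => j.
    rewrite !tnth_mktuple; by case: (tnth m j); case: (_ \in F).
  rewrite (bigID (fun j => tnth (in_tuple p) j \notin F)) /=.
  by congr (_ * _); apply: eq_bigl => j; rewrite tnth_mktuple ?negbK.
move=> /(reduced_word_closedC Fcl xF) H1 /(reduced_word_closed Fcl fF) H2.
(* A mask for [x] selects only letters outside [F], one for [f] only letters in [F], so separating
   their union returns both. *)
congr (_, _); apply: eq_from_tnth => j; rewrite !tnth_mktuple;
  have := mask_tnth (j := j) H1; have := mask_tnth (j := j) H2;
  case: (tnth m1 j); case: (tnth m2 j); case: (_ \in F) => //= h1 h2;
  by [have := h1 isT | have := h2 isT].
Qed.

(** * Schubert classes, and adjoining whole components to [P] *)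

Variable rw : weyl D -> seq 'I_n.
Hypothesis rw_reduced : forall u, reduced_word (rw u) u.
Local Notation sigma := (schubert R rw).

Lemma schubertE u v : sigma v u = billey R (rw u) v.
Proof. by rewrite ffunE. Qed.

Lemma schubert_mulE u v w :
  (sigma v * sigma w) u = billey R (rw u) v * billey R (rw u) w.
Proof. rewrite ffunE; congr (_ * _); exact: schubertE. Qed.

(** The regrouping by which a factor from W_F passes between the two sides of a basis product. *)
Lemma fixfun_mulAC (g h k : fixfun R D) : g * (h * k) = g * k * h.
Proof. by rewrite -mulrA; congr (_ * _); apply: ffun_mulC. Qed.

Lemma schubert1 : sigma 1%g = 1.
Proof. by apply/ffunP => u; rewrite schubertE billey1 ffunE. Qed.

Lemma schubert_closed F x f : closed (@dynkin D) F ->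
  x \in weylP (~: F) -> f \in weylP F -> sigma (x * f)%g = sigma x * sigma f.
Proof.
move=> Fcl xF fF; apply/ffunP => u.
by rewrite (schubertE u (x * f)%g) (billey_closed _ Fcl xF fF) -schubert_mulE.
Qed.

Lemma parabolic_basisP P t :
  reflect (exists v w, [/\ v \in minrep P, w \in weylP P & t = sigma v * sigma w])
    (t \in parabolic_basis R rw P).
Proof.
apply: (iffP (imfset2P _ _ _ _ _)) => [[v vP [w wP ->]]|[v [w [vP wP ->]]]].
  by exists v, w.
by exists v => //; exists w.
Qed.

Lemma closed_mul F u : closed (@dynkin D) F ->
  exists x f, [/\ x \in weylP (~: F), f \in weylP F & u = (x * f)%g].
Proof.
move=> Fcl; have [p <- _] := len_wordP u.
exists (wprod [seq a <- p | a \notin F]), (wprod [seq a <- p | a \in F]).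
by rewrite filterC_weylP filter_weylP -wprod_split.
Qed.

(** As W_P lies in the complementary factor, [f] adds the same length to both sides of each
    comparison. *)
Lemma minrep_closed F P x f : closed (@dynkin D) F -> [disjoint P & F] ->
  x \in weylP (~: F) -> f \in weylP F ->
  ((x * f)%g \in minrep P) = (x \in minrep P).
Proof.
rewrite disjoints_subset => Fcl PF xF fF; rewrite !inE.
apply: eq_forallb_in => z zP; rewrite /wmul mulgA.
have zxF : (z * x)%g \in weylP (~: F).
  by rewrite groupM // (subsetP (weylP_sub PF)).
by rewrite (len_closed Fcl xF fF) (len_closed Fcl zxF fF) leq_add2r.
Qed.

Lemma minrep_union F P v : closed (@dynkin D) F -> [disjoint P & F] ->
  (v \in minrep (P :|: F)) = (v \in minrep P) && (v \in weylP (~: F)).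
Proof.
move=> Fcl dPF; have PF : P \subset ~: F by rewrite -disjoints_subset.
have [x [f [xF fF ->]]] := closed_mul v Fcl.
rewrite (minrep_closed Fcl dPF xF fF); apply/idP/andP => [|[xP xfF]].
  rewrite inE => /forall_inP H.
  (* Testing minimality against the inverse of [f] cancels the [F] part, whose length must then be
     zero. *)
  have f1 : f = 1%g.
    have := H f^-1%g; rewrite /wmul groupV (subsetP (weylP_sub (subsetUr P F))) //.
    move=> /(_ isT); rewrite (closed_commute Fcl xF fF) mulKg -(closed_commute Fcl xF fF).
    rewrite (len_closed Fcl) // -[X in (_ <= X)%N]addn0 leq_add2l leqn0 => /eqP f0.
    by have [q Eq] := len_wordP f; rewrite f0 -Eq => /size0nil ->.
  rewrite f1 mulg1 in H *; split=> //.
  rewrite inE; apply/forall_inP => w wP; apply: H.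
  by apply: subsetP wP; rewrite weylP_sub ?subsetUl.
have f1 : f = 1%g.
  apply: (@weylP_disjoint D F (~: F)) => //; first by rewrite -subsets_disjoint.
  by rewrite -[f](mulKg x) groupM ?groupV.
rewrite f1 mulg1 inE; apply/forall_inP => w.
case/(closed_mul_sub Fcl) => y [g [yP gF ->]].
have {}yP : y \in weylP P.
  by apply: subsetP yP; rewrite weylP_sub // setDUl setDv setU0 subsetDl.
have yF : y \in weylP (~: F) by apply: subsetP yP; apply: weylP_sub.
have {}gF : g \in weylP F by apply: subsetP gF; rewrite weylP_sub ?subsetIr.
have -> : wmul x (y * g)%g = ((y * x) * g)%g.
  by rewrite /wmul -!mulgA (closed_commute Fcl xF gF).
rewrite (len_closed Fcl (groupM yF xF) gF).
move: xP; rewrite inE => /forall_inP /(_ y yP) H.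
by apply: leq_trans H _; rewrite leq_addr.
Qed.

(** For [g] in W_F, sigma_v sigma_(y g) = sigma_(v g) sigma_y: adjoining [F] to [P] shifts the [F]
    part from the first index to the second without changing the product. *)
Lemma parabolic_basis_closed F P : closed (@dynkin D) F -> [disjoint P & F] ->
  parabolic_basis R rw (P :|: F) = parabolic_basis R rw P.
Proof.
move=> Fcl dPF; have PF : P \subset ~: F by rewrite -disjoints_subset.
apply/fsetP => t; apply/parabolic_basisP/parabolic_basisP.
  case=> v [w [+ + ->]]; rewrite minrep_union // => /andP[vP vF].
  case/(closed_mul_sub Fcl) => y [g [yP gF ->]].
  have {}yP : y \in weylP P.
    by apply: subsetP yP; rewrite weylP_sub // setDUl setDv setU0 subsetDl.
  have yF : y \in weylP (~: F) by apply: subsetP yP; apply: weylP_sub.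
  have {}gF : g \in weylP F by apply: subsetP gF; rewrite weylP_sub ?subsetIr.
  exists (v * g)%g, y; split; [by rewrite (minrep_closed Fcl dPF vF gF)|exact: yP|].
  rewrite (schubert_closed Fcl vF gF) (schubert_closed Fcl yF gF).
  exact: fixfun_mulAC.
case=> v [w [+ wP ->]]; have [x [f [xF fF ->]]] := closed_mul v Fcl.
rewrite (minrep_closed Fcl dPF xF fF) => xP.
have wF : w \in weylP (~: F) by apply: subsetP wP; apply: weylP_sub.
exists x, (w * f)%g; split.
- by rewrite (minrep_union _ Fcl dPF) xP xF.
- rewrite groupM //.
    by apply: subsetP wP; rewrite weylP_sub ?subsetUl.
  by apply: subsetP fF; rewrite weylP_sub ?subsetUr.
- rewrite (schubert_closed Fcl xF fF) (schubert_closed Fcl wF fF).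
  exact/esym/fixfun_mulAC.
Qed.

(** * Membership of sigma_(s_a s_b) in B_P, for an edge *)

Lemma rw_pair a b : dynkin a b -> rw (wprod [:: a; b]) = [:: a; b].
Proof. by move=> ab; apply/eqP; rewrite -dynkin_pair_reduced. Qed.

Lemma reduced_word_simple p a : reduced_word p (s a) = (p == [:: a]).
Proof.
apply/reduced_wordP/eqP => [[E]|->]; last by rewrite wprod1 len_simple_refl.
rewrite len_simple_refl; case: p E => [|c []] //.
by rewrite wprod1 => /simple_refl_inj ->.
Qed.

Lemma billey_pair a b : dynkin a b ->
  [/\ billey R [:: a; b] (s a) != 0, billey R [:: a; b] (s b) != 0 &
      billey R [:: a; b] (wprod [:: a; b]) != 0].
Proof.
move=> ab; have /andP[/negPf a_b _] := ab; have b_a : (b == a) = false by rewrite eq_sym.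
(* The masks keep the first letter, the second, or both; each is the only one whose subword is
   reduced for the element in question. *)
split; [pose m0 := [:: true; false]|pose m0 := [:: false; true]|pose m0 := [:: true; true]];
  apply: (billey_neq0 (m0 := m0)) => //= -[|i [|j []]] //= _;
  rewrite ?reduced_word_simple ?dynkin_pair_reduced //;
  by case: i j => [] [] /=; rewrite ?eqseq_cons ?eqxx ?a_b ?b_a ?andbF.
Qed.

Lemma billey_pair_supp a b v : billey R [:: a; b] v != 0 ->
  [\/ v = 1%g, v = s a, v = s b | v = wprod [:: a; b]].
Proof.
case/billey_supp => -[|i [|j []]] // _ /reduced_wordP[+ _].
rewrite -(wprod1 a) -(wprod1 b); case: i j => [] [] <-;
  [exact: Or44 | exact: Or42 | exact: Or43 | exact: Or41].
Qed.

Lemma billey_pair_rev a b : dynkin a b -> billey R [:: b; a] (wprod [:: a; b]) = 0.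
Proof.
move=> ab; apply/eqP; apply: contraT => /billey_supp[m szm].
rewrite dynkin_pair_reduced // => /eqP E; have /andP[/negPf a_b _] := ab.
by case: m szm E => [|i [|j []]] //= _; case: i j => [] [] //= [] E; rewrite ?E eqxx in a_b.
Qed.

Lemma schubert_pair_in a b P : dynkin a b ->
  (sigma (wprod [:: a; b]) \in parabolic_basis R rw P) = (a \in P) || (b \notin P).
Proof.
move=> ab; apply/parabolic_basisP/orP => [[v [w [vP wP E]]]|H].
  have [aP|aP] := boolP (a \in P); [by left|right].
  apply/negP => bP.
  have ba : dynkin b a by rewrite dynkin_sym.
  have [_ _ ab0] := billey_pair ab; have [b0 a0 _] := billey_pair ba.
  (* Two fixed points are compared: at s_a s_b the class is nonzero, which limits [v] and [w]; at
     s_b s_a it vanishes. *)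
  have E1 := congr1 (fun g : fixfun R D => g (wprod [:: a; b])) E.
  have E2 := congr1 (fun g : fixfun R D => g (wprod [:: b; a])) E.
  move: E1 E2; rewrite !schubert_mulE !(schubertE _ (wprod _)) !rw_pair //.
  rewrite billey_pair_rev // => E1 /esym/eqP; apply/negP.
  move: ab0; rewrite E1 mulf_eq0 negb_or => /andP[v0 w0].
  have vE : billey R [:: b; a] v != 0.
    case: (billey_pair_supp v0) vP => -> vP.
    - by rewrite billey1 oner_neq0.
    - exact: a0.
    - exact: b0.
    by exfalso; move: vP; rewrite (dynkin_pair_minrep _ ab) bP.
  have wE : billey R [:: b; a] w != 0.
    case: (billey_pair_supp w0) wP => -> wP.
    - by rewrite billey1 oner_neq0.
    - exact: a0.
    - exact: b0.
    by exfalso; move: wP; rewrite (dynkin_pair_weylP P ab) (negPf aP).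
  exact (mulf_neq0 vE wE).
have minrep1 : 1%g \in minrep P.
  by rewrite inE; apply/forall_inP => w _; rewrite len1.
(* s_a s_b lies in W^P when [b] is outside [P], and in W_P when both ends are inside; the other
   factor is sigma_1 = 1. *)
have [bP|bP] := boolP (b \in P); last first.
  exists (wprod [:: a; b]), 1%g; split; [by rewrite (dynkin_pair_minrep _ ab)|exact: group1|].
  by rewrite schubert1 mulr1.
case: H => [aP|]; last by rewrite bP.
exists 1%g, (wprod [:: a; b]); split; [exact: minrep1| |by rewrite schubert1 mul1r].
by rewrite dynkin_pair_weylP // aP.
Qed.

End Billey.

(** * Dynkin components and the factors of the Weyl group *)

Section Components.
Import Defs.
Variable D : basedRootDatum.
Local Notation n := (semisimple_rank D).
Implicit Types (a b : 'I_n) (P Q C : {set 'I_n}).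

Definition dynkin_component a : {set 'I_n} := [set b | connect (@dynkin D) a b].

Lemma dynkin_connect_sym : connect_sym (@dynkin D).
Proof. exact/sym_connect_sym/dynkin_sym. Qed.

Lemma dynkin_componentsE :
  dynkin_components D = [set dynkin_component a | a in [set: 'I_n]].
Proof. by apply: eq_imset => a; apply/setP => b; rewrite !inE. Qed.

Lemma dynkin_component_closed a : closed (@dynkin D) (dynkin_component a).
Proof.
apply: (intro_closed dynkin_connect_sym) => b c bc; rewrite !inE => ab.
exact: connect_trans ab (connect1 bc).
Qed.

Lemma dynkin_components_closed C : C \in dynkin_components D -> closed (@dynkin D) C.
Proof.
rewrite dynkin_componentsE => /imsetP[a _ ->]; exact: dynkin_component_closed.
Qed.

Lemma dynkin_components_connect C a b :
  C \in dynkin_components D -> a \in C -> b \in C -> connect (@dynkin D) a b.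
Proof.
rewrite dynkin_componentsE => /imsetP[c _ ->]; rewrite !inE => ca.
by apply: connect_trans; rewrite dynkin_connect_sym.
Qed.

(** Intersecting with W_C gives the standard subgroup of [P :&: C], and standard subgroups determine
    their vertices. The next two lemmas translate likewise. *)
Lemma weylP_cap_eq P Q C : C \in dynkin_components D ->
  (weylP P :&: weylP C == weylP Q :&: weylP C) = (P :&: C == Q :&: C).
Proof.
move=> /dynkin_components_closed Ccl; rewrite !(weylP_cap_closed _ Ccl).
exact: (inj_eq (@weylP_inj D)).
Qed.

Lemma weylP_cap_eq1 P C : C \in dynkin_components D ->
  (weylP P :&: weylP C == [set 1%g]) = (P :&: C == set0).
Proof.
move=> /dynkin_components_closed Ccl; rewrite !(weylP_cap_closed _ Ccl) -weylP0.
exact: (inj_eq (@weylP_inj D)).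
Qed.

Lemma weylP_cap_eqr P C : C \in dynkin_components D ->
  (weylP P :&: weylP C == weylP C) = (P :&: C == C).
Proof.
move=> /dynkin_components_closed Ccl; rewrite !(weylP_cap_closed _ Ccl).
exact: (inj_eq (@weylP_inj D)).
Qed.

Definition full_part P : {set 'I_n} := [set a | dynkin_component a \subset P].

Lemma full_part_sub P : full_part P \subset P.
Proof.
by apply/subsetP => a; rewrite inE => /subsetP; apply; rewrite inE connect0.
Qed.

Lemma full_part_closed P : closed (@dynkin D) (full_part P).
Proof.
move=> a b ab; rewrite !inE.
suff -> : dynkin_component a = dynkin_component b by [].
apply/setP => c; rewrite !inE.
by apply: (same_connect dynkin_connect_sym); apply: connect1.
Qed.

End Components.

(** * Equality of bases, component by component *)

Section Comparison.
Import Defs.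
Variables (R : realType) (D : basedRootDatum).
Local Notation n := (semisimple_rank D).
Variable rw : weyl D -> seq 'I_n.
Hypothesis rw_reduced : forall u, reduced_word (rw u) u.
Implicit Types (a b : 'I_n) (P Q C : {set 'I_n}).

Lemma parabolic_basis_trim P :
  parabolic_basis R rw P = parabolic_basis R rw (P :\: full_part P).
Proof.
rewrite -[in LHS](setID P (full_part P)) setUC (setIidPr (full_part_sub P)).
apply: parabolic_basis_closed; first exact: full_part_closed.
by rewrite disjoints_subset setDE subsetIr.
Qed.

(** Removing the full components leaves nothing over a component where the set was empty or full, so
    [P] and [Q] have the same trimmed form. *)
Lemma parabolic_basis_eq P Q :
  (forall C, C \in dynkin_components D -> P :&: C = Q :&: C \/
    P :&: C \in [set set0; C] /\ Q :&: C \in [set set0; C]) ->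
  parabolic_basis R rw P = parabolic_basis R rw Q.
Proof.
have trivial P' a : P' :&: dynkin_component a \in [set set0; dynkin_component a] ->
    a \notin P' :\: full_part P'.
  case/set2P => [E|/setIidPr sub]; rewrite !inE ?sub //.
  by have /setP/(_ a) := E; rewrite !inE connect0 andbT => ->; rewrite andbF.
move=> H; rewrite parabolic_basis_trim [RHS]parabolic_basis_trim; congr parabolic_basis.
apply/setP => a; have aD : dynkin_component a \in dynkin_components D.
  by rewrite dynkin_componentsE imset_f.
have [E|[/trivial /negPf -> /trivial /negPf ->]//] := H _ aD.
have sub P' : (dynkin_component a \subset P') =
    (P' :&: dynkin_component a == dynkin_component a) by apply/setIidPr/eqP.
rewrite !inE !sub E.
by have /setP/(_ a) := E; rewrite !inE connect0 !andbT => ->.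
Qed.

(* Equality of the bases forces the indicator functions of P and Q to have the
   same increment along every edge, hence to differ by a constant on C; a
   nonzero constant would make P constant on C. *)
Lemma parabolic_basis_component P Q C :
  parabolic_basis R rw P = parabolic_basis R rw Q -> C \in dynkin_components D ->
  P :&: C != set0 -> P :&: C != C -> P :&: C = Q :&: C.
Proof.
move=> E CD PC0 PCC; have Ccl := dynkin_components_closed CD.
have edge a b : dynkin a b ->
    (a \in P) || (b \notin P) = (a \in Q) || (b \notin Q).
  by move=> ab; rewrite -!(schubert_pair_in R rw_reduced _ ab) E.
have edge' a b : dynkin a b ->
    (b \in P) || (a \notin P) = (b \in Q) || (a \notin Q).
  by rewrite dynkin_sym; apply: edge.
pose A := [set a | (a \in P) == (a \in Q)].
have Acl : closed (@dynkin D) A.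
  move=> a b ab; have := edge a b ab; have := edge' a b ab; rewrite !inE.
  by do 4!case: (_ \in _).
have /set0Pn[a0 /setIP[a0P a0C]] := PC0.
have /subsetPn[a1 a1C a1P] : ~~ (C \subset P).
  by apply: contra PCC => /setIidPr ->.
have AC a : a \in C -> (a \in A) = (a0 \in A).
  move=> aC; apply: (closed_connect Acl).
  exact: (dynkin_components_connect CD).
have [a0A|a0A] := boolP (a0 \in A).
  apply/setP => a; rewrite !inE; have [aC|] := boolP (a \in C); last by rewrite !andbF.
  by have := AC a aC; rewrite a0A inE !andbT => /eqP.
have PCcl : closed (@dynkin D) (P :&: C).
  move=> a b ab; rewrite !inE -(Ccl a b ab).
  have [aC|] := boolP (a \in C); last by rewrite !andbF.
  have bC : b \in C by rewrite -(Ccl a b ab).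
  have := AC a aC; have := AC b bC; rewrite (negPf a0A) !inE.
  have := edge a b ab; have := edge' a b ab.
  by do 4!case: (_ \in _).
have := closed_connect PCcl (dynkin_components_connect CD a0C a1C).
by rewrite !inE a0P a0C (negPf a1P).
Qed.

End Comparison.

Theorem corollary4p4 (R : realType) (D : basedRootDatum)
    (rw : weyl D -> seq 'I_(semisimple_rank D))
    (rw_reduced : forall u : weyl D, reduced_word (rw u) u)
    (dynkin_not_connected : ~ dynkin_connected D)
    (P Q : {set 'I_(semisimple_rank D)}) :
  parabolic_basis R rw P <> parabolic_basis R rw Q <->
  exists C : {set 'I_(semisimple_rank D)},
    [/\ C \in dynkin_components D,
        weylP P :&: weylP C <> weylP Q :&: weylP C
      & (weylP P :&: weylP C <> [set 1%g] /\
         weylP P :&: weylP C <> weylP C) \/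
        (weylP Q :&: weylP C <> [set 1%g] /\
         weylP Q :&: weylP C <> weylP C)].
Proof.
split=> [neq|[C [CD /eqP + +]] E].
  (* On finite sets of vertices the criterion is decidable; its negation gives, for each component,
     the alternative assumed in [parabolic_basis_eq]. *)
  suff /exists_inP[C CD /andP[PQ proper]] : [exists C in dynkin_components D,
      (P :&: C != Q :&: C) &&
      ((P :&: C \notin [set set0; C]) || (Q :&: C \notin [set set0; C]))].
    exists C; split=> //; first by apply/eqP; rewrite weylP_cap_eq.
    case/orP: proper; rewrite !inE negb_or => /andP[H0 H1]; [left|right];
      by split; apply/eqP; rewrite ?weylP_cap_eq1 ?weylP_cap_eqr.
  apply: contra_notT neq; rewrite negb_exists_in => /forall_inP H.
  apply: parabolic_basis_eq => // C /H.
  rewrite negb_and negb_or !negbK => /orP[/eqP|/andP[]]; first by left.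
  by right.
rewrite weylP_cap_eq // => /eqP PQ.
case=> -[/eqP + /eqP]; rewrite weylP_cap_eq1 // weylP_cap_eqr // => H0 H1; apply: PQ.
  exact: parabolic_basis_component E CD H0 H1.
exact/esym/(parabolic_basis_component rw_reduced (esym E) CD H0 H1).
Qed.
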